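(* Let $m\geq 2$ and $j\in\{1,\dots,m-1\}$. Define $\Gamma_j:=\{\gamma\in\mathbb{R}^m \mid \gamma_m\geq\sum_{i=1}^{m-1}|\gamma_i|,\ \gamma_m>|\gamma_j|\}$. Suppose $\gamma\in\Gamma_j\cup\operatorname{interior}(\mathcal{L}^m)$. Consider the function $f_\gamma:\mathbb{R}^m\to\mathbb{R}$ defined by $$f_\gamma(v)=\begin{cases}\gamma^{\top}v+1 & \text{if } v_j\neq 0 \text{ and } \gamma^{\top}v\in\mathbb{Z},\\ \lceil\gamma^{\top}v\rceil & \text{otherwise.}\end{cases}$$ Then $f_\gamma\in\mathcal{F}_{\mathcal{L}^m}$.
   Context: $\mathcal{L}^m:=\{x\in\mathbb{R}^m \mid \sqrt{x_1^2+\dots+x_{m-1}^2}\leq x_m\}$ is the second-order cone in $\mathbb{R}^m$. For a regular cone $K\subseteq\mathbb{R}^m$ (pointed, closed, convex, full dimensional), write $u\succeq_K v$ if $u-v\in K$, and let $\mathcal{F}_K$ be the set of functions $f:\mathbb{R}^m\to\mathbb{R}$ such that: (1) $f$ is subadditive, i.e. $f(u)+f(v)\geq f(u+v)$ for all $u,v\in\mathbb{R}^m$; (2) $f$ is non-decreasing with respect to $K$, i.e. $f(u)\geq f(v)$ whenever $u\succeq_K v$; (3) $f(0)=0$. *)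

(* Defs.v *)
From HB Require Import structures.
From mathcomp Require Import all_boot all_order all_algebra.
From mathcomp Require Import all_classical all_reals all_analysis.
Set Implicit Arguments.
Unset Strict Implicit.
Unset Printing Implicit Defensive.
Import Order.TTheory GRing.Theory Num.Theory.
Import numFieldNormedType.Exports.
Local Open Scope classical_set_scope.
Local Open Scope ring_scope.

(* The ambient space R^m is 'cV[R]_n.+1, i.e. m = n.+1. Coordinates are
   0-based: the last coordinate x_m is x ord_max ord0, and the coordinates
   x_1, ..., x_(m-1) are those whose index differs from ord_max. *)

Definition second_order_cone (R : realType) (n : nat) : set 'cV[R]_n.+1 :=
  [set x | Num.sqrt (\sum_(i < n.+1 | i != ord_max) x i ord0 ^+ 2)
           <= x ord_max ord0].

Definition dot (R : realType) (n : nat) (u v : 'cV[R]_n) : R :=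
  (u^T *m v) ord0 ord0.

Definition cone_ge (R : realType) (n : nat) (K : set 'cV[R]_n)
  (u v : 'cV[R]_n) : Prop := K (u - v).

Definition subadditive (R : realType) (n : nat) (f : 'cV[R]_n -> R) : Prop :=
  forall u v, f u + f v >= f (u + v).

Definition cone_nondecreasing (R : realType) (n : nat) (K : set 'cV[R]_n)
  (f : 'cV[R]_n -> R) : Prop :=
  forall u v, cone_ge K u v -> f u >= f v.

(* Meant for regular cones K (pointed, closed, convex, full dimensional), but
   the definition makes sense for any set K. *)
Definition F_cone (R : realType) (n : nat) (K : set 'cV[R]_n) :
    set ('cV[R]_n -> R) :=
  [set f | [/\ subadditive f, cone_nondecreasing K f & f 0 = 0]].

Definition Gamma (R : realType) (n : nat) (j : 'I_n.+1) : set 'cV[R]_n.+1 :=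
  [set g | g ord_max ord0 >= \sum_(i < n.+1 | i != ord_max) `|g i ord0| /\
           g ord_max ord0 > `|g j ord0|].

Definition f_gamma (R : realType) (n : nat) (j : 'I_n.+1)
    (g : 'cV[R]_n.+1) (v : 'cV[R]_n.+1) : R :=
  if (v j ord0 != 0) && (dot g v \is a Num.int) then dot g v + 1
  else (Num.ceil (dot g v))%:~R.

(* Main.v *)
Require Import Defs.
From HB Require Import structures.
From mathcomp Require Import all_boot all_order all_algebra.
From mathcomp Require Import all_classical all_reals all_analysis.
From mathcomp Require Import ring lra.
Import Order.TTheory GRing.Theory Num.Theory.
Import numFieldNormedType.Exports.
Local Open Scope classical_set_scope.
Local Open Scope ring_scope.

(** Subadditivity of [f_gamma] holds for every [gamma], and monotonicity only
    needs that a cone vector [w] satisfies [0 <= dot gamma w], with strict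
    inequality when [w_j != 0]. For [gamma] in the interior of the cone this is
    the Cauchy-Schwarz inequality applied to [gamma - eps e_m]. For [gamma] in
    [Gamma j], put [t = sqrt (w_m^2 - w_j^2)]: every coordinate other than
    [w_j] and [w_m] is at most [t] in absolute value, and [t < w_m] when
    [w_j != 0]. *)

Lemma dotE (R : realType) (n : nat) (g w : 'cV[R]_n.+1) :
  dot g w = g ord_max ord0 * w ord_max ord0 +
            \sum_(i < n.+1 | i != ord_max) g i ord0 * w i ord0.
Proof.
rewrite /dot mxE (bigD1 ord_max) //= mxE; congr (_ + _).
by apply: eq_bigr => i _; rewrite mxE.
Qed.

Lemma dotD (R : realType) (n : nat) (g u v : 'cV[R]_n) :
  dot g (u + v) = dot g u + dot g v.
Proof. by rewrite /dot mulmxDr mxE. Qed.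

Lemma second_order_coneP (R : realType) (n : nat) (w : 'cV[R]_n.+1) :
  second_order_cone w <->
  0 <= w ord_max ord0 /\
  \sum_(i < n.+1 | i != ord_max) w i ord0 ^+ 2 <= w ord_max ord0 ^+ 2.
Proof.
have s0 : 0 <= \sum_(i < n.+1 | i != ord_max) w i ord0 ^+ 2.
  by apply: sumr_ge0 => i _; exact: sqr_ge0.
rewrite /second_order_cone /=; split=> [h|[w0 h]].
  have w0 := le_trans (sqrtr_ge0 _) h.
  by split=> //; rewrite -(sqr_sqrtr s0) ler_sqr ?nnegrE ?sqrtr_ge0.
by rewrite -(ger0_norm w0) -sqrtr_sqr ler_sqrt ?sqr_ge0.
Qed.

(** Cauchy-Schwarz with [p] and [q] bounding the norms, which avoids square roots: expand the
    nonnegative sum of [(q * x i + p * y i) ^+ 2]. *)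
Lemma sum_mul_ge (R : realFieldType) (I : finType) (P : pred I) (x y : I -> R)
    (p q : R) :
  0 < p -> 0 < q ->
  \sum_(i | P i) x i ^+ 2 <= p ^+ 2 -> \sum_(i | P i) y i ^+ 2 <= q ^+ 2 ->
  - (p * q) <= \sum_(i | P i) x i * y i.
Proof.
move=> p0 q0 hx hy.
have : 0 <= \sum_(i | P i) (q * x i + p * y i) ^+ 2.
  by apply: sumr_ge0 => i _; exact: sqr_ge0.
have -> : \sum_(i | P i) (q * x i + p * y i) ^+ 2 =
    q ^+ 2 * \sum_(i | P i) x i ^+ 2 + p ^+ 2 * \sum_(i | P i) y i ^+ 2
    + 2 * (p * q) * \sum_(i | P i) x i * y i.
  rewrite !mulr_sumr -!big_split /=.
  by apply: eq_bigr => i _; ring.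
have pq0 : 0 < p * q by exact: mulr_gt0.
have h1 := ler_wpM2l (sqr_ge0 q) hx.
have h2 := ler_wpM2l (sqr_ge0 p) hy.
(* The expansion is at most [2 * (p * q) ^+ 2 + 2 * (p * q) * S]. *)
move=> h; rewrite -(ler_pM2l pq0).
set S := \sum_(i | P i) x i * y i in h *.
set A := q ^+ 2 * \sum_(i | P i) x i ^+ 2 in h h1.
set B := p ^+ 2 * \sum_(i | P i) y i ^+ 2 in h h2.
by nra.
Qed.

Lemma cone_coord0 (R : realType) (n : nat) (w : 'cV[R]_n.+1) (i : 'I_n.+1) :
  second_order_cone w -> w ord_max ord0 = 0 -> w i ord0 = 0.
Proof.
move=> /second_order_coneP[_ h] w0.
have [->//|im] := eqVneq i ord_max.
have := h; rewrite w0 expr0n /= (bigD1 i) //= => {}h.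
have s0 : 0 <= \sum_(k < n.+1 | (k != ord_max) && (k != i)) w k ord0 ^+ 2.
  by apply: sumr_ge0 => k _; exact: sqr_ge0.
apply/eqP; rewrite -sqrf_eq0 eq_le sqr_ge0 andbT.
by apply: le_trans h; rewrite lerDl.
Qed.

Lemma interior_dot_gt0 (R : realType) (n : nat) (g w : 'cV[R]_n.+1) :
  interior (@second_order_cone R n) g -> second_order_cone w ->
  0 < w ord_max ord0 -> 0 < dot g w.
Proof.
move=> /nbhs_ballP[e /= e0 ge] /second_order_coneP[_ hw] w0.
(* Balls of matrices are entrywise, so lowering one coordinate by [e / 2] stays in the ball of
   radius [e]. *)
pose g' : 'cV[R]_n.+1 := g - (e / 2) *: delta_mx ord_max ord0.
have g'E i : g' i ord0 = g i ord0 - (e / 2) * (i == ord_max)%:R.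
  by rewrite !mxE eqxx andbT.
have : second_order_cone g'.
  apply: ge; split=> // i k; rewrite (ord1 k) g'E.
  rewrite /ball /= opprB addrC subrK ger0_norm.
    by case: eqP => _; rewrite ?mulr1 ?mulr0; lra.
  by case: eqP => _; rewrite ?mulr1 ?mulr0; lra.
move=> /second_order_coneP[]; rewrite !g'E eqxx mulr1 => p0 hg.
have p1 : 0 < g ord_max ord0 by lra.
have hg' : \sum_(i < n.+1 | i != ord_max) g i ord0 ^+ 2 <=
    (g ord_max ord0 - e / 2) ^+ 2.
  rewrite (eq_bigr (fun i => g' i ord0 ^+ 2)) // => i im.
  by rewrite g'E (negPf im) mulr0 subr0.
rewrite dotE.
(* The bound is taken at [e / 4], which keeps the slack strict and the
   coordinate positive. *)
have p2 : 0 < g ord_max ord0 - e / 4 by lra.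
have hg2 : \sum_(i < n.+1 | i != ord_max) g i ord0 ^+ 2 <=
    (g ord_max ord0 - e / 4) ^+ 2.
  by apply: (le_trans hg'); rewrite ler_sqr ?nnegrE; lra.
have := sum_mul_ge _ _ _ _ _ _ _ p2 w0 hg2 hw.
have : 0 < e / 4 * w ord_max ord0 by apply: mulr_gt0 => //; lra.
by lra.
Qed.

Lemma Gamma_dot_gt0 (R : realType) (n : nat) (j : 'I_n.+1)
    (g w : 'cV[R]_n.+1) :
  j != ord_max -> Gamma j g -> second_order_cone w -> w j ord0 != 0 ->
  0 < dot g w.
Proof.
move=> jm [hS hj] /second_order_coneP[w0 hw] wj.
have hjw : 0 < w j ord0 ^+ 2 by rewrite exprn_even_gt0.
set p := g ord_max ord0 in hS hj *; set q := w ord_max ord0 in w0 hw *.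
have pair i : i != ord_max -> i != j ->
    w j ord0 ^+ 2 + w i ord0 ^+ 2 <= q ^+ 2.
  move=> im ij; apply: le_trans hw.
  rewrite (bigD1 j) //= (bigD1 i) /=; last by rewrite im ij.
  by rewrite addrA lerDl sumr_ge0 // => k _; exact: sqr_ge0.
have wjq : w j ord0 ^+ 2 <= q ^+ 2.
  apply: le_trans hw; rewrite (bigD1 j) //= lerDl.
  by apply: sumr_ge0 => k _; exact: sqr_ge0.
have ajq : `|w j ord0| <= q.
  by rewrite -(ger0_norm w0) -ler_sqr ?nnegrE // !real_normK ?num_real.
pose t := Num.sqrt (q ^+ 2 - w j ord0 ^+ 2).
have tq : t < q.
  rewrite -(ger0_norm w0) -sqrtr_sqr ltr_sqrt; first by lra.
  exact: lt_le_trans wjq.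
have wt i : i != ord_max -> i != j -> `|w i ord0| <= t.
  move=> im ij; rewrite -sqrtr_sqr ler_wsqrtr //.
  by have := pair i im ij; lra.
rewrite dotE -/p -/q (bigD1 j) //=.
move: hS; rewrite (bigD1 j) //=.
set S := \sum_(i < n.+1 | (i != ord_max) && (i != j)) `|g i ord0|.
set D := \sum_(i < n.+1 | _) _ => hS.
have S0 : 0 <= S by apply: sumr_ge0.
have SD : - (S * t) <= D.
  rewrite /S mulr_suml -sumrN; apply: ler_sum => i /andP[im ij].
  rewrite lerNl (le_trans (ler_norm _)) // normrN normrM.
  by rewrite ler_wpM2l // wt.
have jj : - (`|g j ord0| * `|w j ord0|) <= g j ord0 * w j ord0.
  by rewrite -normrM lerNl (le_trans (ler_norm _)) // normrN.
(* The lower bound [p * q - |g_j| * |w_j| - S * t] splits as [(p - |g_j| - S) * q + |g_j| * (q -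
   |w_j|) + S * (q - t)], all terms nonnegative. The last is positive if [S > 0]; if [S = 0], the
   first is, since [p > |g_j|]. *)
have h1 : 0 <= (p - `|g j ord0| - S) * q by apply: mulr_ge0 => //; lra.
have h2 : 0 <= `|g j ord0| * (q - `|w j ord0|).
  by apply: mulr_ge0 => //; lra.
have q0 : 0 < q by apply: le_lt_trans tq; exact: sqrtr_ge0.
have [Sp|Sn] := ltP 0 S.
  have h3 : 0 < S * (q - t) by apply: mulr_gt0 => //; lra.
  by lra.
have S00 : S = 0 by apply/eqP; rewrite eq_le Sn S0.
have h3 : 0 < (p - `|g j ord0|) * q by apply: mulr_gt0 => //; lra.
by rewrite S00 in SD; lra.
Qed.

(** Hölder's inequality for the 1-norm and the sup norm: each [|w_i|] with [i != ord_max] is at most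
    [w_m]. *)
Lemma Gamma_dot_ge0 (R : realType) (n : nat) (j : 'I_n.+1)
    (g w : 'cV[R]_n.+1) :
  Gamma j g -> second_order_cone w -> 0 <= dot g w.
Proof.
move=> [hS _] /second_order_coneP[w0 hw].
have wq i : i != ord_max -> `|w i ord0| <= w ord_max ord0.
  move=> im.
  rewrite -(ger0_norm w0) -ler_sqr ?nnegrE // !real_normK ?num_real //.
  apply: le_trans hw; rewrite (bigD1 i) //= lerDl.
  by apply: sumr_ge0 => k _; exact: sqr_ge0.
rewrite dotE -lerBlDl sub0r.
apply: (@le_trans _ _ (- ((\sum_(i < n.+1 | i != ord_max) `|g i ord0|)
                          * w ord_max ord0))).
  by rewrite lerN2 ler_wpM2r.
rewrite mulr_suml -sumrN; apply: ler_sum => i im.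
rewrite lerNl (le_trans (ler_norm _)) // normrN normrM.
by rewrite ler_wpM2l // wq.
Qed.

Lemma interior_dot_ge0 (R : realType) (n : nat) (g w : 'cV[R]_n.+1) :
  interior (@second_order_cone R n) g -> second_order_cone w ->
  0 <= dot g w.
Proof.
move=> hg hw; have /second_order_coneP[w0 _] := hw.
have [wm|wm] := ltP 0 (w ord_max ord0).
  by apply/ltW; exact: interior_dot_gt0.
have wm0 : w ord_max ord0 = 0 by apply/eqP; rewrite eq_le wm.
by rewrite dotE big1 ?wm0 ?mulr0 ?addr0 // => i _; rewrite (cone_coord0 _ _ w) ?mulr0.
Qed.

(** The exceptional branch adds 1 to an integer, which is its own ceiling. *)
Lemma f_gamma_ge_ceil (R : realType) (n : nat) (j : 'I_n.+1)
    (g v : 'cV[R]_n.+1) :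
  (Num.ceil (dot g v))%:~R <= f_gamma j g v.
Proof.
rewrite /f_gamma; case: ifP => // /andP[_ hv].
by rewrite ceilK // lerDl.
Qed.

Lemma ceil_int_ge (R : realType) (x : R) (k : int) :
  k%:~R < x -> (k%:~R + 1 : R) <= (Num.ceil x)%:~R.
Proof. by move=> kx; rewrite -(intrD R k 1) ler_int lezD1 ceil_gt_int. Qed.

(** Only the extra 1 at [u + v] goes beyond subadditivity of the ceiling. There [u_j] or [v_j] is
    nonzero, and [key] treats [u_j != 0]. *)
Lemma f_gamma_subadditive (R : realType) (n : nat) (j : 'I_n.+1)
    (g : 'cV[R]_n.+1) : Defs.subadditive (f_gamma j g).
Proof.
have key (u v : 'cV[R]_n.+1) : u j ord0 != 0 -> dot g (u + v) \is a Num.int ->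
    dot g (u + v) + 1 <= f_gamma j g u + f_gamma j g v.
  move=> uj; rewrite dotD => uvZ; have fv := f_gamma_ge_ceil _ _ j g v.
  have cv := ceil_ge (dot g v).
  (* If [dot g u] is an integer, [u] brings its own extra 1. Otherwise rounding it up is strict, so
     the sum of the ceilings is an integer above the integer [dot g (u + v)], hence larger by at
     least 1. *)
  have [uZ|uZ] := boolP (dot g u \is a Num.int).
    by rewrite {1}/f_gamma uj uZ /=; lra.
  rewrite {1}/f_gamma uj (negPf uZ) /=.
  have cu : dot g u < (Num.ceil (dot g u))%:~R.
    rewrite lt_neqAle ceil_ge andbT; apply: contra uZ => /eqP ->.
    exact: intr_int.
  move: uvZ => /intrP[k uvk].
  have : (k%:~R + 1 : R) <= (Num.ceil (dot g u))%:~R + (Num.ceil (dot g v))%:~R.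
    by rewrite -(intrD R k 1) -intrD ler_int lezD1 -(ltr_int R) intrD; lra.
  by lra.
move=> u v; rewrite {1}/f_gamma; case: ifP => [/andP[uvj uvZ]|_].
  have [uj|uj] := eqVneq (u j ord0) 0; last exact: key.
  rewrite [leRHS]addrC (addrC u); apply: key; last by rewrite addrC.
  by move: uvj; rewrite mxE uj add0r.
apply: le_trans (lerD (f_gamma_ge_ceil _ _ j g u) (f_gamma_ge_ceil _ _ j g v)).
rewrite dotD -intrD ler_int ceil_le_int intrD.
by apply: lerD; exact: ceil_ge.
Qed.

(** If [dot g (u - v) = 0], then [u_j = v_j] and both values come from the same branch. Otherwise
    [dot g u > dot g v], and the ceiling of [dot g u] absorbs a possible extra 1 at [v]. *)
Lemma f_gamma_nondecreasing (R : realType) (n : nat) (j : 'I_n.+1)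
    (g : 'cV[R]_n.+1) (K : set 'cV[R]_n.+1) :
  (forall w, K w -> 0 <= dot g w) ->
  (forall w, K w -> w j ord0 != 0 -> 0 < dot g w) ->
  cone_nondecreasing K (f_gamma j g).
Proof.
move=> ge0 gt0 u v Kw.
have uE : dot g u = dot g v + dot g (u - v).
  by rewrite -dotD addrC subrK.
have := ge0 _ Kw; rewrite le_eqVlt => /orP[/eqP w0|w0].
  have uvj : u j ord0 = v j ord0.
    apply/eqP; rewrite -subr_eq0; apply: contraT => uvj.
    have := gt0 _ Kw; rewrite !mxE => /(_ uvj).
    by rewrite -w0 ltxx.
  by rewrite /f_gamma uvj uE -w0 addr0.
apply: le_trans (f_gamma_ge_ceil _ _ j g u).
rewrite {1}/f_gamma; case: ifP => [/andP[_ /intrP[k vk]]|_].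
  by rewrite vk; apply: ceil_int_ge; lra.
by rewrite ler_int le_ceil //; lra.
Qed.

Theorem theorem2 (R : realType) (n : nat) (hm : (2 <= n.+1)%N)
    (j : 'I_n.+1) (hj : j != ord_max) (gamma : 'cV[R]_n.+1)
    (hgamma : (@Gamma R n j `|` interior (@second_order_cone R n)) gamma) :
  @F_cone R n.+1 (@second_order_cone R n) (f_gamma j gamma).
Proof.
split.
- exact: f_gamma_subadditive.
- apply: f_gamma_nondecreasing => w hw.
    by case: hgamma => hg; [exact: (Gamma_dot_ge0 _ _ j)|exact: interior_dot_ge0].
  case: hgamma => hg wj; first exact: (Gamma_dot_gt0 _ _ j).
  (* Here [w_m > 0]: a cone vector with [w_m = 0] vanishes, against [w_j != 0]. *)
  apply: interior_dot_gt0 => //; have /second_order_coneP[w0 _] := hw.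
  rewrite lt_neqAle w0 andbT eq_sym; apply: contra wj => /eqP wm.
  by rewrite cone_coord0.
- by rewrite /f_gamma mxE eqxx /= /dot mulmx0 mxE ceil0.
Qed.
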